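(* Let $\bm q=(q_0,q_1,\ldots,q_n)$, with $q_i\in\mathcal{S}^h(\mathbb{R}^2)$, $q_0\neq0$, with $W_{\bm q}$ surjective and $q_0(1,Z)^k$ non-negative on $\mathbb{R}$. Let $$\bm \varphi:\mathbb{R}\setminus \mathcal{Z}(q_0(1,Z))\to\mathbb{R}^n;\quad z\mapsto\left(\frac{q_1(1,z)}{q_0(1,z)},\ldots,\frac{q_n(1,z)}{q_0(1,z)}\right),\qquad \mathcal{C}:=\mathrm{Im}(\bm\varphi).$$ For a positive Borel measure $\mu$ supported on $\mathcal{C}$ with finite moments up to degree $k$, let $r(\mu)\le\lceil\frac{hk+1}{2}\rceil$ be the rank of the Hankel matrix $H$ associated with $\mu$ (defined in the context). It is known that $\mu$ has a quadrature formula of strength $k$ with $r(\mu)$ nodes on $\mathcal{C}$ if $r(\mu)\ne\frac{hk+1}{2}$, and with $r(\mu)+1$ nodes on $\mathcal{C}$ if $r(\mu)=\frac{hk+1}{2}$. These bounds are sharp in the following sense. (a) For every integer $r$ with $1\le r\le\lceil\frac{hk+1}{2}\rceil$ and $r\neq\frac{hk+1}{2}$, there exists a positive Borel measure $\mu$ supported on $\mathcal{C}$ with $r(\mu)=r$ that has no quadrature formula of strength $k$ with fewer than $r$ nodes, all on $\mathcal{C}$. (b) If $r=\frac{hk+1}{2}$ is an integer and $q_0(1,Z_1)$ has a real root, then there exists a positive Borel measure $\mu$ supported on $\mathcal{C}$ with $r(\mu)=r$ that has no quadrature formula of strength $k$ with fewer than $r+1$ nodes, all on $\mathcal{C}$.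
   Context: Let $n,k,h$ be positive integers and $\mathbb{N}_0=\{0,1,2,\dots\}$. $\mathcal{S}^d(\mathbb{R}^{N+1})$ is the space of real homogeneous polynomials (forms) of degree $d$ in $N+1$ variables; variables are $\bm X=(X_0,\dots,X_n)$ for $\mathcal{S}^k(\mathbb{R}^{n+1})$ and $\bm Z=(Z_0,Z_1)$ for binary forms. $\mathcal{Z}(f)$ denotes the set of real zeros of $f$. $\binom{d}{\bm\alpha}=\frac{d!}{\prod\alpha_i!}$. $W_{\bm q}:\mathcal{S}^k(\mathbb{R}^{n+1})\to\mathcal{S}^{hk}(\mathbb{R}^{2})$ is the linear map $\bm X^{\bm\alpha}\mapsto \prod_i q_i(\bm Z)^{\alpha_i}$. The apolar product on degree $d$ forms is $\langle f,g\rangle_d=\sum_{\bm\alpha}\binom{d}{\bm\alpha}^{-1}f_{\bm\alpha}g_{\bm\alpha}$ (where $f_{\bm\alpha},g_{\bm\alpha}$ are the monomial coefficients), and $A_d$ is the isomorphism $f\mapsto\langle f,\cdot\rangle_d$ onto the dual space. Put $\phi_{\bm q}=A_k^{-1}\circ W_{\bm q}^*\circ A_{hk}:\mathcal{S}^{hk}(\mathbb{R}^{2})\to\mathcal{S}^k(\mathbb{R}^{n+1})$, with $W_{\bm q}^*$ the transpose of $W_{\bm q}$; $\bm q\text{-}\mathrm{Sym}_{k,n+1}:=\mathrm{Im}(\phi_{\bm q})$. When $W_{\bm q}$ is surjective, $\phi_{\bm q}$ is injective and $\psi_{\bm q}:\bm q\text{-}\mathrm{Sym}_{k,n+1}\to\mathcal{S}^{hk}(\mathbb{R}^2)$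 denotes its inverse. Hankel matrix associated with $\mu$: let $p_{\bm\alpha}=\int X_1^{\alpha_1}\cdots X_n^{\alpha_n}\,\mathrm{d}\mu$ for $\bm\alpha\in\mathbb{N}_0^n$, $|\bm\alpha|\le k$, and $p=\sum_{|\bm\alpha|\le k}\binom{k}{(k-|\bm\alpha|,\alpha_1,\dots,\alpha_n)}p_{\bm\alpha}X_0^{k-|\bm\alpha|}X_1^{\alpha_1}\cdots X_n^{\alpha_n}$. Under the hypotheses, $p\in\bm q\text{-}\mathrm{Sym}_{k,n+1}$. Write $\psi_{\bm q}(p)=\sum_{j=0}^{hk}\binom{hk}{j}c_jZ_0^{hk-j}Z_1^j$; then $H=\operatorname{Hankel}((c_0,\dots,c_{hk}))$ is the $(\lfloor hk/2\rfloor+1)\times(\lceil hk/2\rceil+1)$ matrix with entries $c_{i+j}$, and $r(\mu)=\mathrm{rank}(H)$. A measure is supported on $\mathcal{C}$ if the complement of $\mathcal{C}$ has measure zero. A quadrature formula of strength $k$ for $\mu$ is a finitely atomic measure $\nu=\sum_{i=1}^s\lambda_i\delta_{\bm\xi_i}$ with $\lambda_i>0$, $\bm\xi_i\in\mathbb{R}^n$ (distinct; the nodes; $s$ is the number of nodes), such that the moments of $\mu$ and $\nu$ coincide up to degree $k$. *)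

(* Defs.v *)
From HB Require Import structures.
From mathcomp Require Import all_boot all_order all_algebra.
From mathcomp Require Import mpoly.
From mathcomp Require Import all_classical all_reals all_analysis.

Set Implicit Arguments.
Unset Strict Implicit.
Unset Printing Implicit Defensive.

Import Order.TTheory GRing.Theory Num.Theory.
Local Open Scope classical_set_scope.
Local Open Scope ring_scope.

(* The vector space S^d(R^{N+1}) *)
Notation hform R N d := (dhomog N.+1 R d).

Section Apolar.
Variables (R : realFieldType) (N d : nat).
Implicit Types f g : hform R N d.

(* Only used for |m| = d. *)
Definition multinomial (m : 'X_{1..N.+1}) : R :=
  d`!%:R / (\prod_(i < N.+1) (m i)`!)%:R.

Definition apolar f g : R :=
  \sum_(m : 'X_{1..N.+1 < d.+1} | mdeg m == d)
    (multinomial m)^-1 * f@_m * g@_m.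

Lemma apolar_is_linear f : linear (apolar f : hform R N d -> R^o).
Proof.
move=> c g1 g2; rewrite /apolar scaler_sumr -big_split /=.
apply: eq_bigr => m _; rewrite mcoeffD mcoeffZ mulrDr; congr (_ + _).
by rewrite mulrCA.
Qed.

HB.instance Definition _ f :=
  GRing.isLinear.Build R (hform R N d) R^o _ (apolar f : hform R N d -> R^o)
    (apolar_is_linear f).

Definition apolar_form f : 'Hom(hform R N d, R^o) :=
  linfun (apolar f : hform R N d -> R^o).

Lemma apolar_form_is_linear : linear apolar_form.
Proof.
move=> c f1 f2; apply/lfunP => g; rewrite add_lfunE scale_lfunE !lfunE /=.
rewrite /apolar scaler_sumr -big_split /=.
apply: eq_bigr => m _; rewrite mcoeffD mcoeffZ mulrDr mulrDl; congr (_ + _).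
by rewrite [RHS]/GRing.scale /= mulrCA !mulrA.
Qed.

HB.instance Definition _ :=
  GRing.isLinear.Build R (hform R N d) 'Hom(hform R N d, R^o) _ apolar_form
    apolar_form_is_linear.

(* A_d : f |-> <f, .>_d *)
Definition apolar_iso : 'Hom(hform R N d, 'Hom(hform R N d, R^o)) :=
  linfun apolar_form.

Lemma apolar_isoE f g : apolar_iso f g = apolar f g.
Proof. by rewrite lfunE /= lfunE. Qed.

Lemma multinomial_gt0 m : 0 < multinomial m.
Proof.
by rewrite divr_gt0 ?ltr0n ?fact_gt0 ?prodn_gt0 // => i; rewrite fact_gt0.
Qed.

Lemma apolar_iso_inj : lker apolar_iso == 0%VS.
Proof.
rewrite -subv0; apply/subvP => f; rewrite memv_ker memv0 => /eqP/lfunP/(_ f).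
rewrite apolar_isoE zero_lfunE => ff0; apply/eqP/val_inj/mpolyP => m /=.
rewrite mcoeff0; have [md|md] := eqVneq (mdeg m) d; last first.
  exact: dhomog_nemf_coeff (dhomog_is_dhomog f) md.
have md1 : (mdeg m < d.+1)%N by rewrite md.
have term0 : (multinomial m)^-1 * f@_m * f@_m = 0.
  move/psumr_eq0P: ff0 => /(_ _ (BMultinom md1)) -> //=; last by rewrite md.
  move=> m' _; rewrite -mulrA mulr_ge0 ?invr_ge0 ?(ltW (multinomial_gt0 _)) //.
  by rewrite -expr2 sqr_ge0.
move/eqP: term0; rewrite -mulrA mulf_eq0 invr_eq0.
by rewrite (gt_eqF (multinomial_gt0 _)) /= -expr2 sqrf_eq0 => /eqP.
Qed.

Lemma apolar_iso_surj : limg apolar_iso = fullv.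
Proof.
apply/eqP; rewrite eqEdim subvf /= limg_dim_eq; last first.
  by rewrite (eqP apolar_iso_inj) capv0.
by rewrite !dimvf /= /dim /= muln1.
Qed.

End Apolar.
Arguments apolar_iso {R} N d.


Section Transpose.
Variables (R : fieldType) (U V : vectType R).

Definition precomp (W : 'Hom(U, V)) (l : 'Hom(V, R^o)) : 'Hom(U, R^o) :=
  (l \o W)%VF.

Lemma precomp_is_linear W : linear (precomp W).
Proof.
by move=> c l1 l2; rewrite /precomp comp_lfunDl comp_lfunZl.
Qed.

HB.instance Definition _ W :=
  GRing.isLinear.Build R 'Hom(V, R^o) 'Hom(U, R^o) _ (precomp W)
    (precomp_is_linear W).

Definition transpose (W : 'Hom(U, V)) : 'Hom('Hom(V, R^o), 'Hom(U, R^o)) :=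
  linfun (precomp W).

Lemma transposeE W l u : transpose W l u = l (W u).
Proof. by rewrite lfunE /= comp_lfunE. Qed.

End Transpose.

Section QSym.
Variables (R : realFieldType) (n k h : nat) (q : 'I_n.+1 -> hform R 1 h).

Definition substq (f : {mpoly R[n.+1]}) : {mpoly R[2]} :=
  f \mPo [tuple q i : {mpoly R[2]} | i < n.+1].

Lemma substqX (m : 'X_{1..n.+1}) :
  substq 'X_[m] = \prod_(i < n.+1) (q i : {mpoly R[2]}) ^+ m i.
Proof.
by rewrite /substq comp_mpolyX; apply: eq_bigr => i _; rewrite tnth_mktuple.
Qed.

Lemma substq_homog (f : hform R n k) : substq f \is (h * k).-homog.
Proof.
rewrite (mpolyE f) /substq raddf_sum /=; rewrite big_seq.
apply: rpred_sum => m mm; rewrite comp_mpolyZ; apply: rpredZ.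
have /dhomogP/(_ m mm) <- := dhomog_is_dhomog f.
rewrite -/(substq _) substqX.
have -> : (h * mdeg m = \sum_(i < n.+1) h * m i)%N by rewrite mdegE big_distrr.
apply: (big_ind2 (fun (p : {mpoly R[2]}) e => p \is e.-homog)) => [|p e p' e'|i _].
- exact: dhomog1.
- exact: dhomogM.
- exact/dhomogMn/dhomog_is_dhomog.
Qed.

Definition substq_form (f : hform R n k) : hform R 1 (h * k) :=
  DHomog (substq_homog f).

Lemma substq_form_is_linear : linear substq_form.
Proof. by move=> c f g; apply/val_inj; rewrite /= /substq linearP. Qed.

HB.instance Definition _ :=
  GRing.isLinear.Build R (hform R n k) (hform R 1 (h * k)) _ substq_form
    substq_form_is_linear.

Definition Wq : 'Hom(hform R n k, hform R 1 (h * k)) := linfun substq_form.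

Lemma WqE f : Wq f = substq_form f. Proof. by rewrite lfunE. Qed.

Definition phiq : 'Hom(hform R 1 (h * k), hform R n k) :=
  ((apolar_iso n k)^-1 \o (transpose Wq \o apolar_iso 1 (h * k)))%VF.

Definition qSym : {vspace hform R n k} := limg phiq.

(* The inverse of phi_q on qSym when W_q is surjective: see psiqK. *)
Definition psiq : 'Hom(hform R n k, hform R 1 (h * k)) := (phiq^-1)%VF.

Lemma phiq_inj : (forall g, exists f, Wq f = g) -> lker phiq == 0%VS.
Proof.
move=> Wsurj; rewrite -subv0; apply/subvP => g.
rewrite memv_ker memv0 !comp_lfunE => /eqP; set l := transpose Wq _ => lE.
have l0 : l = 0.
  by rewrite -(@limg_lfunVK _ _ _ (apolar_iso n k) l) ?lE ?linear0 //
    apolar_iso_surj memvf.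
apply/eqP/(lker0P (apolar_iso_inj R 1 (h * k))); rewrite linear0.
apply/lfunP => g'; have [f <-] := Wsurj g'.
by rewrite -transposeE -/l l0 !zero_lfunE.
Qed.

Lemma psiqK : (forall g, exists f, Wq f = g) -> {in qSym, cancel psiq phiq} /\
  cancel phiq psiq.
Proof.
by move=> Wsurj; split; [exact: limg_lfunVK | exact/lker0_lfunK/phiq_inj].
Qed.

End QSym.
Arguments Wq {R n} k {h} q.
Arguments phiq {R n} k {h} q.
Arguments qSym {R n} k {h} q.
Arguments psiq {R n} k {h} q.

Section Hankel.
Variables (R : realFieldType) (d : nat).

(* The c_j with g = sum_j binom(d, j) c_j Z_0^(d - j) Z_1^j *)
Definition binary_coef (g : hform R 1 d) (j : nat) : R :=
  g@_[multinom if i == ord0 then (d - j)%N else j | i < 2] / 'C(d, j)%:R.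

Definition Hankel (c : nat -> R) : 'M[R]_((d./2).+1, (uphalf d).+1) :=
  \matrix_(i, j) c (i + j)%N.

End Hankel.
Arguments Hankel {R} d c.

(* f(1, z) *)
Definition dehom (R : realFieldType) (d : nat) (f : hform R 1 d) (z : R) : R :=
  f.@[fun i => if i == ord0 then 1 else z].

Section Curve.
Variables (R : realFieldType) (n h : nat) (q : 'I_n.+1 -> hform R 1 h).

(* Only meaningful where q_0(1, z) != 0. *)
Definition curve_map (z : R) : n.-tuple R :=
  [tuple dehom (q (lift ord0 i)) z / dehom (q ord0) z | i < n].

Definition curve : set (n.-tuple R) :=
  curve_map @` [set z | dehom (q ord0) z != 0].

End Curve.

Section Measures.
Variables (R : realType) (n : nat).
(* The sigma-algebra of n.-tuple R is the product of the Borel sigma-algebras of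
   R, which is the Borel sigma-algebra of R^n. *)
Implicit Types mu nu : {measure set (n.-tuple R) -> \bar R}.

Definition supported_on mu (C : set (n.-tuple R)) := mu.-negligible (~` C).

Definition monomial (a : 'X_{1..n}) (x : n.-tuple R) : R :=
  \prod_(i < n) tnth x i ^+ a i.

Definition finite_moments mu (k : nat) := forall a : 'X_{1..n},
  (mdeg a <= k)%N -> mu.-integrable setT (EFin \o monomial a).

Definition moment mu (a : 'X_{1..n}) : R := \int[mu]_x monomial a x.

(* (k - |a|, a_1, ..., a_n) *)
Definition homogenize (k : nat) (a : 'X_{1..n}) : 'X_{1..n.+1} :=
  [multinom if unlift ord0 i is Some j then a j else (k - mdeg a)%N | i < n.+1].

Lemma mdeg_homogenize k (a : 'X_{1..n}) :
  (mdeg a <= k)%N -> mdeg (homogenize k a) = k.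
Proof.
move=> ak; rewrite mdegE big_ord_recl mnmE unlift_none.
under eq_bigr => i _ do rewrite mnmE liftK.
by rewrite -mdegE subnK.
Qed.

Definition moment_poly mu (k : nat) : {mpoly R[n.+1]} :=
  \sum_(a : 'X_{1..n < k.+1})
    (multinomial R k (homogenize k a) * moment mu a) *: 'X_[homogenize k a].

Lemma moment_poly_homog mu k : moment_poly mu k \is k.-homog.
Proof.
apply: rpred_sum => a _; apply: rpredZ; rewrite dhomogX /=.
by rewrite mdeg_homogenize // -ltnS; exact: bmdeg.
Qed.

Definition moment_form mu (k : nat) : hform R n k :=
  DHomog (moment_poly_homog mu k).

(* psiq is a genuine inverse only on qSym; moment_form mu k lies in qSym k q
   whenever mu is supported on curve q and W_q is surjective. *)
Definition hankel_rank h (q : 'I_n.+1 -> hform R 1 h) (k : nat) mu : nat :=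
  \rank (Hankel (h * k) (binary_coef (psiq k q (moment_form mu k)))).

Definition is_atomic nu (s : nat) (lambda : 'I_s -> R) (xi : 'I_s -> n.-tuple R) :=
  [/\ forall i, 0 < lambda i, injective xi &
      forall A, measurable A ->
        nu A = (\sum_(i < s) (lambda i)%:E * \d_(xi i) A)%E].

Definition has_quadrature mu (C : set (n.-tuple R)) (k s : nat) :=
  exists nu (lambda : 'I_s -> R) (xi : 'I_s -> n.-tuple R),
    [/\ is_atomic nu lambda xi, forall i, C (xi i) &
        forall a : 'X_{1..n}, (mdeg a <= k)%N -> moment mu a = moment nu a].

End Measures.

(* Main.v *)
(** For a measure with moments those of [\sum_i l_i \delta_(\varphi(y_i))], the
    form [psi_q(p)] is [\sum_i l_i q_0(1, y_i)^-k (Z_0 + y_i Z_1)^(hk)], so its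
    Hankel matrix factors through Vandermonde matrices: its rank is at most the
    number of nodes, and equals it when the [y_i] are distinct and not too many.
    This gives (a), with any atomic measure on [r] nodes.

    For (b), let [z] be a root of [q_0(1, Z)] and interlace points
    [w_0 < z_1 = z < w_1 < z_2 < ... < z_r < w_r], the [w_i] not being roots of
    [q_0(1, Z)]. The divided difference at these [2r + 1] points vanishes on
    polynomials of degree at most [2r - 1 = hk] and its coefficients alternate
    in sign, so that some measure on the [w_i] has the same functional as a
    positive combination of evaluations at the [z_i]. If [s <= r] nodes [y_i]
    gave a quadrature formula, testing on
    [\prod_i (X - y_i) \prod_(j != 1) (X - z_j)], which vanishes at the [y_i]
    and at every [z_j] but [z], would force [z] to be one of the [y_i]; but
    [q_0(1, z) = 0]. *)

Require Import Defs.
From mathcomp Require Import all_boot all_order all_algebra.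
From mathcomp Require Import mpoly.
From mathcomp Require Import all_classical all_reals all_analysis.
From mathcomp Require Import measurable_realfun zify ring polyrcf.

Set Implicit Arguments.
Unset Strict Implicit.
Unset Printing Implicit Defensive.

Import Order.TTheory GRing.Theory Num.Theory.
Local Open Scope classical_set_scope.
Local Open Scope ring_scope.

(** * Apolar product in monomial coordinates *)

Section ApolarMonomials.
Variables (R : realFieldType) (N d : nat).

(** The multinomial factors in the coefficients of [g] cancel the inverse multinomials of the apolar
    product, which leaves an unweighted pairing. *)
Lemma apolarE (I : finType) (M : I -> 'X_{1..N.+1}) (c : I -> R)
    (g f : hform R N d) :
  (forall i, mdeg (M i) = d) ->
  val g = \sum_i (multinomial R d (M i) * c i) *: 'X_[M i] ->
  apolar g f = \sum_i c i * f@_(M i).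
Proof.
move=> Md gE; rewrite /apolar -[mpoly_of_dhomog g]/(val g) gE.
under eq_bigr => m _ do rewrite raddf_sum big_distrr /= big_distrl /=.
rewrite exchange_big /=; apply: eq_bigr => i _.
have Mi : (mdeg (M i) < d.+1)%N by rewrite Md.
rewrite (bigD1 (BMultinom Mi)) /=; last by rewrite Md.
rewrite mcoeffZ mcoeffX eqxx mulr1 mulKf ?gt_eqF ?multinomial_gt0 //.
rewrite big1 ?addr0 // => m /andP[_ mi]; rewrite mcoeffZ mcoeffX.
suff /negbTE -> : M i != m by rewrite !mulr0 mul0r.
by apply: contraNneq mi => Mm; apply/eqP/val_inj.
Qed.

Lemma dhomog_sumX (I : finType) (M : I -> 'X_{1..N.+1}) (f : hform R N d) :
  (forall i, mdeg (M i) = d) -> injective M ->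
  (forall m, mdeg m = d -> exists i, M i = m) ->
  val f = \sum_i f@_(M i) *: 'X_[M i].
Proof.
move=> Md Minj Msurj; apply/mpolyP => m; rewrite raddf_sum /=.
have [md|md] := eqVneq (mdeg m) d; last first.
  rewrite (dhomog_nemf_coeff (dhomog_is_dhomog f) md) big1 // => i _.
  rewrite mcoeffZ mcoeffX; case: eqP => [Mm|_]; last by rewrite mulr0.
  by rewrite -Mm Md eqxx in md.
have [i <-] := Msurj _ md.
rewrite (bigD1 i) //= mcoeffZ mcoeffX eqxx mulr1 big1 ?addr0 // => j ji.
by rewrite mcoeffZ mcoeffX (inj_eq Minj) (negbTE ji) mulr0.
Qed.

End ApolarMonomials.

(** * Binary forms and evaluation at points $(1, z)$ *)

Section BinaryForms.
Variables (R : realFieldType) (d : nat).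

Definition bmon (j : nat) : 'X_{1..2} :=
  [multinom if i == ord0 then (d - j)%N else j | i < 2].

Lemma mdeg_bmon j : (j <= d)%N -> mdeg (bmon j) = d.
Proof.
by move=> jd; rewrite mdegE 2!big_ord_recl big_ord0 !mnmE /= addn0 subnK.
Qed.

Lemma bmon_inj : injective bmon.
Proof.
by move=> i j /mnmP/(_ (lift ord0 ord0)); rewrite !mnmE.
Qed.

Lemma bmon_surj (m : 'X_{1..2}) :
  mdeg m = d -> exists i : 'I_d.+1, bmon i = m.
Proof.
rewrite mdegE 2!big_ord_recl big_ord0 addn0 => md.
have jd : (m (lift ord0 ord0) < d.+1)%N by rewrite ltnS -md leq_addl.
exists (Ordinal jd); apply/mnmP => i; rewrite mnmE /=.
case: eqP => [->|/eqP i0]; first by rewrite -[in LHS]md addnK.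
by congr (m _); apply/val_inj; case: i i0 => [[|[|]]].
Qed.

Lemma multinomial_bmon j : (j <= d)%N -> multinomial R d (bmon j) = 'C(d, j)%:R.
Proof.
move=> jd; rewrite /multinomial 2!big_ord_recl big_ord0 !mnmE /= muln1.
rewrite -(bin_fact jd) [X in _ / X%:R]mulnC natrM mulfK //.
Qed.

Definition dehom_poly (f : hform R 1 d) : {poly R} := \poly_(j < d.+1) f@_(bmon j).

Lemma dehom_monomials (f : hform R 1 d) :
  val f = \sum_(j < d.+1) f@_(bmon j) *: 'X_[bmon j].
Proof.
apply: dhomog_sumX => [i|i j /bmon_inj/val_inj //|]; last exact: bmon_surj.
by rewrite mdeg_bmon // -ltnS.
Qed.

Lemma dehomE (f : hform R 1 d) z : dehom f z = (dehom_poly f).[z].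
Proof.
rewrite /dehom -[mpoly_of_dhomog f]/(val f) dehom_monomials raddf_sum /=.
rewrite horner_poly; apply: eq_bigr => j _; rewrite mevalZ mevalX.
by rewrite 2!big_ord_recl big_ord0 !mnmE /= expr1n mul1r mulr1.
Qed.

Lemma dehom_poly_eq0 (f : hform R 1 d) : dehom_poly f = 0 -> f = 0.
Proof.
move=> f0; apply/val_inj; rewrite dehom_monomials big1 // => j _.
have := coef_poly d.+1 (fun j => f@_(bmon j)) j.
by rewrite ltn_ord -/(dehom_poly f) f0 coef0 => <-; rewrite scale0r.
Qed.

(** A right inverse of [binary_coef] on the indices up to [d]. *)
Definition bform_poly (c : nat -> R) : {mpoly R[2]} :=
  \sum_(j < d.+1) (multinomial R d (bmon j) * c j) *: 'X_[bmon j].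

Lemma bform_homog c : bform_poly c \is d.-homog.
Proof.
apply: rpred_sum => j _; apply: rpredZ.
by rewrite dhomogX /= mdeg_bmon // -ltnS.
Qed.

Definition bform c : hform R 1 d := DHomog (bform_homog c).

Lemma apolar_bform c f : apolar (bform c) f = \sum_(j < d.+1) c j * f@_(bmon j).
Proof. by apply: apolarE => // j; rewrite mdeg_bmon // -ltnS. Qed.

(** The form on the left is $\sum_i w_i (Z_0 + y_i Z_1)^d$, and pairing with $(Z_0 + y Z_1)^d$ is
    evaluation at $(1, y)$. *)
Lemma apolar_bform_dehom (s : nat) (w y : 'I_s -> R) f :
  apolar (bform (fun j => \sum_i w i * y i ^+ j)) f = \sum_i w i * dehom f (y i).
Proof.
rewrite apolar_bform; under eq_bigr => j _ do rewrite mulr_suml.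
rewrite exchange_big; apply: eq_bigr => i _ /=.
rewrite dehomE horner_poly mulr_sumr; apply: eq_bigr => j _.
by rewrite -mulrA [_ ^+ j * _]mulrC.
Qed.

Lemma binary_coef_bform c j : (j <= d)%N -> binary_coef (bform c) j = c j.
Proof.
move=> jd; rewrite /binary_coef -/(bmon j) /= raddf_sum /=.
have jd1 : (j < d.+1)%N by [].
rewrite (bigD1 (Ordinal jd1)) //= mcoeffZ mcoeffX eqxx mulr1 big1 ?addr0.
  by rewrite multinomial_bmon // mulrC mulKf // pnatr_eq0 -lt0n bin_gt0.
move=> i ij; rewrite mcoeffZ mcoeffX (inj_eq bmon_inj).
suff /negbTE -> : val i != j by rewrite mulr0.
by apply: contraNneq ij => ij; apply/eqP/val_inj.
Qed.

End BinaryForms.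

(** * Moment forms and their images under $\psi_q$ *)

Section MomentForm.
Variables (R : realType) (n k h : nat) (q : 'I_n.+1 -> hform R 1 h).

Lemma homogenize_inj : injective (@homogenize n k).
Proof.
move=> a b /mnmP ab; apply/mnmP => i.
by have := ab (lift ord0 i); rewrite !mnmE liftK.
Qed.

Lemma homogenize_surj (m : 'X_{1..n.+1}) :
  mdeg m = k -> exists a : 'X_{1..n < k.+1}, homogenize k a = m.
Proof.
move=> mk; pose a := [multinom m (lift ord0 i) | i < n].
have aE : (m ord0 + mdeg a = k)%N.
  rewrite -mk [in RHS]mdegE big_ord_recl mdegE; congr (_ + _)%N.
  by apply: eq_bigr => i _; rewrite mnmE.
have ak : (mdeg a < k.+1)%N by rewrite ltnS -aE leq_addl.
exists (BMultinom ak); apply/mnmP => i; rewrite mnmE /=.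
by case: unliftP => [j ->|->]; rewrite ?mnmE // -aE addnK.
Qed.

Lemma hform_homogenize (f : hform R n k) :
  val f = \sum_(a : 'X_{1..n < k.+1}) f@_(homogenize k a) *: 'X_[homogenize k a].
Proof.
apply: dhomog_sumX => [a|a b|]; last exact: homogenize_surj.
- by rewrite mdeg_homogenize // -ltnS; exact: bmdeg.
- by move=> /homogenize_inj/val_inj.
Qed.

Lemma meval_hform (f : hform R n k) (v : 'I_n.+1 -> R) :
  f.@[v] = \sum_(a : 'X_{1..n < k.+1}) f@_(homogenize k a) *
    (v ord0 ^+ (k - mdeg a) * \prod_(i < n) v (lift ord0 i) ^+ a i).
Proof.
rewrite -[mpoly_of_dhomog f]/(val f) [in LHS]hform_homogenize raddf_sum /=.
apply: eq_bigr => a _; rewrite mevalZ mevalX big_ord_recl !mnmE unlift_none.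
by congr (_ * (_ * _)); apply: eq_bigr => i _; rewrite mnmE liftK.
Qed.

(** Substitution turns a homogenized monomial into $q_0^{k-|a|} \prod_i q_i^{a_i}$; factoring out
    $q_0^k$ leaves a monomial in the quotients $q_i/q_0$. *)
Lemma dehom_Wq (f : hform R n k) (z : R) : dehom (q ord0) z != 0 ->
  dehom (Wq k q f) z = dehom (q ord0) z ^+ k *
    \sum_(a : 'X_{1..n < k.+1}) f@_(homogenize k a) * monomial a (curve_map q z).
Proof.
move=> q0z; rewrite WqE /dehom /= /substq comp_mpoly_meval meval_hform mulr_sumr.
apply: eq_bigr => a _; rewrite [RHS]mulrCA; congr (_ * _).
have ak : (mdeg a <= k)%N by rewrite -ltnS; exact: bmdeg.
rewrite -[X in _ = _ ^+ X * _](subnK ak) exprD -mulrA tnth_mktuple; congr (_ * _).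
rewrite mdegE -prodrXr /monomial -big_split /=.
apply: eq_bigr => i _; rewrite !tnth_mktuple -exprMn mulrC.
by rewrite -/(dehom _ _) mulfVK.
Qed.

(* By the reproducing property of the apolar product, [psiq] sends the k-th
   power of the linear form with coefficients [q_i(1, y)] to the (hk)-th power
   of [Z_0 + y Z_1]. *)
Lemma binary_coef_psiq
    (Wsurj : forall g : hform R 1 (h * k), exists f, Wq k q f = g)
    (mu : {measure set (n.-tuple R) -> \bar R}) (s : nat) (l y : 'I_s -> R) :
  (forall i, dehom (q ord0) (y i) != 0) ->
  (forall a : 'X_{1..n}, (mdeg a <= k)%N ->
     moment mu a = \sum_i l i * monomial a (curve_map q (y i))) ->
  forall j, (j <= h * k)%N ->
  binary_coef (psiq k q (moment_form mu k)) j =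
  \sum_i l i / dehom (q ord0) (y i) ^+ k * y i ^+ j.
Proof.
move=> q0y momE j jd.
pose c j := \sum_i l i / dehom (q ord0) (y i) ^+ k * y i ^+ j.
suff -> : moment_form mu k = phiq k q (bform (h * k) c).
  by have [_ ->] := psiqK Wsurj; rewrite binary_coef_bform.
(* Applying $A_k$ cancels its inverse in [phiq]; what remains is an equality of functionals, tested
   on each form [f]. *)
apply: (lker0P (apolar_iso_inj R n k)).
rewrite /phiq comp_lfunE limg_lfunVK ?apolar_iso_surj ?memvf //.
apply/lfunP => f; rewrite comp_lfunE transposeE !apolar_isoE apolar_bform_dehom.
rewrite (@apolarE _ _ _ _ (fun a : 'X_{1..n < k.+1} => homogenize k a)
          (fun a => moment mu a)) //; last first.
  by move=> a; rewrite mdeg_homogenize // -ltnS; exact: bmdeg.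
under eq_bigr => a _ do rewrite (momE a (bmdeg a)) mulr_suml.
rewrite exchange_big; apply: eq_bigr => i _ /=.
rewrite dehom_Wq // mulrA mulfVK ?expf_neq0 // mulr_sumr.
by under [RHS]eq_bigr => a _ do rewrite [_ * monomial _ _]mulrC mulrA.
Qed.

End MomentForm.

(** * Finitely atomic measures and their moments *)

Section AtomicMeasures.
Variables (R : realType) (n : nat).

Lemma measurable_monomial (a : 'X_{1..n}) :
  measurable_fun setT (monomial a : n.-tuple R -> R).
Proof.
apply: measurable_prod => i _; apply: measurable_funX; exact: measurable_tnth.
Qed.

Lemma measurable_tuple1 (x : n.-tuple R) : measurable [set x].
Proof.
have -> : [set x] = \bigcap_(i in [set: 'I_n]) (@tnth n R ^~ i) @^-1` [set tnth x i].
  rewrite eqEsubset; split => [_ -> i _ //|z zx].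
  by apply: eq_from_tnth => i; exact: zx.
apply: fin_bigcap_measurable => // i _.
by rewrite -[X in measurable X]setTI; apply: measurable_tnth.
Qed.

Section Atoms.
Variables (s : nat) (l : 'I_s -> R) (xi : 'I_s -> n.-tuple R).
Hypothesis l_gt0 : forall i, 0 < l i.

(** [msum] takes a sequence indexed by [nat], so indices from [s] on receive the zero measure. *)
Definition atom (j : nat) : {measure set (n.-tuple R) -> \bar R} :=
  if insub j is Some i then mscale (NngNum (ltW (l_gt0 i))) \d_(xi i) else mzero.

Definition atomic : {measure set (n.-tuple R) -> \bar R} := msum atom s.

Lemma atomicE (A : set (n.-tuple R)) :
  atomic A = (\sum_(i < s) (l i)%:E * \d_(xi i) A)%E.
Proof.
rewrite /atomic /= /msum; apply: eq_bigr => i _.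
by rewrite /atom valK.
Qed.

Variable nu : {measure set (n.-tuple R) -> \bar R}.
Hypothesis nuE : forall A, measurable A ->
  nu A = (\sum_(i < s) (l i)%:E * \d_(xi i) A)%E.

(** [nu] agrees with [atomic] on measurable sets, which is how [is_atomic] describes it; its
    integrals thus reduce to Dirac integrals. *)
Lemma ge0_integral_atomic (f : n.-tuple R -> \bar R) :
  measurable_fun setT f -> (forall x, 0 <= f x)%E ->
  (\int[nu]_x f x = \sum_(i < s) (l i)%:E * f (xi i))%E.
Proof.
move=> mf f0; rewrite (eq_measure_integral atomic) => [|A mA _]; last first.
  by rewrite atomicE nuE.
rewrite ge0_integral_measure_sum //; apply: eq_bigr => i _.
rewrite /atom valK ge0_integral_mscale // integral_dirac //.
by rewrite diracT mul1e.
Qed.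

Lemma integral_atomic (f : n.-tuple R -> R) : measurable_fun setT f ->
  (\int[nu]_x (f x)%:E = (\sum_(i < s) l i * f (xi i))%:E)%E.
Proof.
move=> /measurable_EFinP mf; rewrite integralE !ge0_integral_atomic //.
- under eq_bigr => i _ do rewrite funeposE -EFin_max -EFinM.
  under [X in (_ - X)%E]eq_bigr => i _ do rewrite funenegE -EFinN -EFin_max -EFinM.
  rewrite !sumEFin -EFinB; congr EFin; rewrite -sumrB; apply: eq_bigr => i _.
  rewrite -mulrBr; congr (_ * _).
  have [f0|f0] := leP 0 (f (xi i)).
    by rewrite max_r ?subr0 // oppr_le0.
  by rewrite max_l ?sub0r ?opprK // oppr_ge0 ltW.
- exact: measurable_funeneg.
- exact: measurable_funepos.
Qed.

Lemma moment_atomic (a : 'X_{1..n}) :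
  moment nu a = \sum_i l i * monomial a (xi i).
Proof. by rewrite /moment /Rintegral integral_atomic //; exact: measurable_monomial. Qed.

Lemma finite_moments_atomic k : finite_moments nu k.
Proof.
move=> a _; apply/integrableP; split.
  by apply/measurable_EFinP; exact: measurable_monomial.
rewrite (eq_integral (fun x => `|monomial a x|%:E)) //.
rewrite integral_atomic ?ltry //; apply: measurableT_comp => //.
exact: measurable_monomial.
Qed.

Lemma supported_atomic (C : set (n.-tuple R)) :
  (forall i, C (xi i)) -> supported_on nu C.
Proof.
(* [C] is an arbitrary set, so the measurable null set is taken to be the complement of the finitely
   many atoms. *)
move=> Cxi; exists (~` \bigcup_(i in [set: 'I_s]) [set xi i]); split.
- apply: measurableC; apply: fin_bigcup_measurable => // i _.
  exact: measurable_tuple1.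
- rewrite nuE; last first.
    apply: measurableC; apply: fin_bigcup_measurable => // i _.
    exact: measurable_tuple1.
  rewrite big1 // => i _; rewrite diracE memNset ?mule0 //=.
  by move=> /(_ (ex_intro2 _ _ i Logic.I erefl)).
- by apply: subsetC => x [i _ ->].
Qed.

End Atoms.
End AtomicMeasures.

(** * Linear combinations of point evaluations on polynomials *)

Section PointEvaluations.
Variable F : fieldType.

Lemma sum_horner (m s : nat) (p : {poly F}) (w y : 'I_s -> F) :
  (size p <= m)%N ->
  \sum_i w i * p.[y i] = \sum_(j < m) p`_j * \sum_i w i * y i ^+ j.
Proof.
move=> pm; under eq_bigr => i _ do rewrite (horner_coef_wide _ pm) mulr_sumr.
rewrite exchange_big; apply: eq_bigr => j _ /=.
by rewrite mulr_sumr; apply: eq_bigr => i _; rewrite mulrCA.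
Qed.

Lemma sum_horner_eq (m s t : nat) (w y : 'I_s -> F) (v z : 'I_t -> F) :
  (forall j, (j < m)%N -> \sum_i w i * y i ^+ j = \sum_i v i * z i ^+ j) ->
  forall p : {poly F}, (size p <= m)%N ->
  \sum_i w i * p.[y i] = \sum_i v i * p.[z i].
Proof.
by move=> wv p pm; rewrite !(sum_horner _ _ pm); apply: eq_bigr => j _; rewrite wv.
Qed.

Lemma horner_prod_XsubC_neq0 (I : finType) (P : pred I) (y : I -> F) z :
  (forall i, P i -> z != y i) -> (\prod_(i | P i) ('X - (y i)%:P)).[z] != 0.
Proof.
move=> zy; rewrite horner_prod; apply/prodf_neq0 => i /zy.
by rewrite !hornerE subr_eq0.
Qed.

Lemma horner_prod_XsubC_eq0 (I : finType) (P : pred I) (y : I -> F) i :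
  P i -> (\prod_(i | P i) ('X - (y i)%:P)).[y i] = 0.
Proof. by move=> Pi; rewrite horner_prod (bigD1 i) //= !hornerE subrr mul0r. Qed.

Lemma size_prod_XsubC_ord (s : nat) (P : pred 'I_s) (y : 'I_s -> F) :
  size (\prod_(i | P i) ('X - (y i)%:P)) = #|P|.+1.
Proof. by rewrite -big_filter size_prod_XsubC size_filter -sum1_count sum1_card. Qed.

(** A vector in the left kernel gives a combination of evaluations that kills all polynomials of
    degree below [m]; the product vanishing at every node but [y i] isolates its [i]-th entry. *)
Lemma row_free_Vandermonde (s m : nat) (w y : 'I_s -> F) :
  injective y -> (forall i, w i != 0) -> (s <= m)%N ->
  row_free (\matrix_(i < s, j < m) (w i * y i ^+ j)).
Proof.
move=> yinj w0 sm; apply: inj_row_free => u /rowP uV; apply/rowP => i.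
pose p := \prod_(j | j != i) ('X - (y j)%:P).
have pm : (size p <= m)%N.
  by rewrite size_prod_XsubC_ord cardC1 card_ord prednK // (leq_ltn_trans _ (ltn_ord i)).
have := sum_horner (fun i => u 0 i * w i) y pm.
rewrite [RHS]big1 => [|j _]; last first.
  rewrite (_ : \sum_t _ = 0) ?mulr0 //; have := uV j; rewrite !mxE => uVj.
  by rewrite -[RHS]uVj; apply: eq_bigr => t _; rewrite mxE mulrA.
rewrite (bigD1 i) //= big1 ?addr0 => [/eqP|j ji]; last first.
  by rewrite horner_prod_XsubC_eq0 ?mulr0.
rewrite !mulf_eq0 (negbTE (w0 i)) orbF mxE => /orP[/eqP //|].
rewrite (negbTE (horner_prod_XsubC_neq0 _)) // => j.
by rewrite (inj_eq yinj) eq_sym.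
Qed.

(* The sum is the coefficient of [X^N] in the Lagrange interpolant of [p]. *)
Lemma divided_difference_eq0 (N : nat) (x : 'I_N.+1 -> F) (p : {poly F}) :
  injective x -> (size p <= N)%N ->
  \sum_i p.[x i] / \prod_(j | j != i) (x i - x j) = 0.
Proof.
move=> xinj pN; pose l i := \prod_(j | j != i) ('X - (x j)%:P).
have lE i : (l i).[x i] = \prod_(j | j != i) (x i - x j).
  by rewrite horner_prod; apply: eq_bigr => j _; rewrite !hornerE.
have sl i : size (l i) = N.+1 by rewrite size_prod_XsubC_ord cardC1 card_ord.
have lmon i : l i \is monic by apply: monic_prod_XsubC.
pose L := \sum_i (p.[x i] / \prod_(j | j != i) (x i - x j)) *: l i.
have Lx i : L.[x i] = p.[x i].
  rewrite horner_sum (bigD1 i) //= hornerZ lE mulfVK; last first.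
    by rewrite -lE horner_prod_XsubC_neq0 // => j; rewrite (inj_eq xinj) eq_sym.
  rewrite big1 ?addr0 // => j ji; rewrite hornerZ horner_prod_XsubC_eq0 ?mulr0 //.
  by rewrite eq_sym.
have /eqP : L - p = 0.
  apply: (@roots_geq_poly_eq0 _ _ [seq x i | i <- enum 'I_N.+1]).
  - by apply/allP => _ /mapP[i _ ->]; rewrite rootE !hornerE Lx subrr.
  - by rewrite map_inj_uniq ?enum_uniq.
  - rewrite size_map size_enum_ord (leq_trans (size_polyD _ _)) // geq_max size_polyN.
    rewrite (leq_trans pN) // andbT; rewrite (leq_trans (size_sum _ _ _)) //; apply/bigmax_leqP => i _.
    by rewrite (leq_trans (size_scale_leq _ _)) ?sl.
rewrite subr_eq0 => /eqP Lp.
have LN : L`_N = 0 by rewrite Lp nth_default.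
rewrite -[RHS]LN coef_sum; apply: eq_bigr => i _; rewrite coefZ.
by have /eqP := monicP (lmon i); rewrite /lead_coef sl /= => /eqP ->; rewrite mulr1.
Qed.

End PointEvaluations.

(** * Rank of Hankel matrices of power sums *)

Section HankelRank.
Variables (R : realFieldType) (d s : nat) (c : nat -> R) (w y : 'I_s -> R).
Hypothesis cE : forall j, (j <= d)%N -> c j = \sum_i w i * y i ^+ j.

Lemma Hankel_sum : Hankel d c =
  (\matrix_(i < s, a < d./2.+1) (1 * y i ^+ a))^T *m
  \matrix_(i < s, b < (uphalf d).+1) (w i * y i ^+ b).
Proof.
apply/matrixP => a b; rewrite !mxE cE.
  by apply: eq_bigr => i _; rewrite !mxE mul1r exprD mulrCA.
(* The largest index is $\lfloor d/2\rfloor + \lceil d/2\rceil = d$, still in the range of [cE]. *)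
rewrite -[leqRHS](odd_double_half d) -addnn addnCA -uphalf_half.
by rewrite leq_add // -ltnS.
Qed.

Lemma rank_Hankel_le : (\rank (Hankel d c) <= s)%N.
Proof. by rewrite Hankel_sum (leq_trans (mxrankM_maxl _ _)) ?rank_leq_col. Qed.

(** Both Vandermonde matrices have at least $\lfloor d/2\rfloor + 1$ columns, so the bound on [s]
    makes the rows of each independent. *)
Lemma rank_Hankel : injective y -> (forall i, w i != 0) -> (s <= d./2.+1)%N ->
  \rank (Hankel d c) = s.
Proof.
move=> yinj w0 sd; rewrite Hankel_sum mxrankMfree.
  by rewrite mxrank_tr; apply/eqP/row_free_Vandermonde => // i; exact: oner_neq0.
apply: row_free_Vandermonde => //; rewrite (leq_trans sd) // ltnS.
by rewrite uphalf_half leq_addl.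
Qed.

End HankelRank.

(** * Positive weights from divided differences *)

Section Interlacing.
Variable R : realFieldType.

Lemma sum_signed_parity (r : nat) (f : nat -> R) :
  \sum_(i < r.*2.+1) (-1) ^+ i * f i =
  \sum_(i < r.+1) f i.*2 - \sum_(i < r) f i.*2.+1.
Proof.
elim: r => [|r IH]; first by rewrite !big_ord_recr !big_ord0 /= !(add0r, mul1r, subr0).
rewrite doubleS 2!big_ord_recr IH [in RHS]big_ord_recr /= [X in _ = _ - X]big_ord_recr /=.
by rewrite !exprS -[_ ^+ r.*2]signr_odd odd_double expr0; ring.
Qed.

(** The negative factors are those with $j > i$, and there are $N - i$ of them. *)
Lemma prod_diff_sign (N : nat) (x : nat -> R) (i : 'I_N.+1) :
  {homo x : a b / (a < b)%N >-> a < b} ->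
  \prod_(j < N.+1 | j != i) (x i - x j) =
  (-1) ^+ (N - i) * \prod_(j < N.+1 | j != i) `|x i - x j|.
Proof.
move=> xhomo.
have cnt M : (\sum_(j < M) (i < j) = M - i.+1)%N.
  elim: M => [|M IH]; first by rewrite big_ord0.
  by rewrite big_ord_recr /= IH; case: ltnP => iM; lia.
have -> : (N - i = \sum_(j < N.+1 | j != i) (i < j))%N.
  by rewrite -subSS -cnt (bigD1 i) //= ltnn add0n.
rewrite -prodrXr -big_split; apply: eq_bigr => j ji /=.
have [ij|ij|ij] := ltngtP i j.
- by rewrite expr1 mulN1r ltr0_norm ?opprK // subr_lt0 xhomo.
- by rewrite expr0 mul1r gtr0_norm // subr_gt0 xhomo.
- by move: ji; rewrite -val_eqE /= ij eqxx.
Qed.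

Lemma interlacing_moments (r : nat) (x : nat -> R) :
  {homo x : a b / (a < b)%N >-> a < b} ->
  exists e : nat -> R, (forall i, 0 < e i) /\
    forall p : {poly R}, (size p <= r.*2)%N ->
    \sum_(i < r.+1) e i.*2 * p.[x i.*2] = \sum_(i < r) e i.*2.+1 * p.[x i.*2.+1].
Proof.
move=> xhomo.
have xinj : injective x.
  by move=> a b; case: (ltngtP a b) => // /xhomo + ab; rewrite ab ltxx.
(* For $i \le 2r$ these are the absolute values of the divided difference coefficients. *)
pose e i : R := (\prod_(j < r.*2.+1 | j != i :> nat) `|x i - x j|)^-1.
exists e; split => [i|p pr].
  rewrite invr_gt0; apply: prodr_gt0 => j ji.
  by rewrite normr_gt0 subr_eq0 (inj_eq xinj) eq_sym.
apply/eqP; rewrite -subr_eq0 -(sum_signed_parity r (fun i => e i * p.[x i])).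
apply/eqP; rewrite -[RHS](divided_difference_eq0 (x := fun i : 'I_r.*2.+1 => x i) _ pr).
  apply: eq_bigr => i _; rewrite prod_diff_sign // invfM.
  have ir : (i <= r.*2)%N by rewrite -ltnS.
  (* Since $2r$ is even, $(-1)^{2r-i} = (-1)^i$: even points get a plus sign, odd points a minus
     sign. *)
  rewrite -[_ ^+ (_ - _)]signr_odd oddB // odd_double /= invr_sign signr_odd.
  by rewrite [RHS]mulrCA; congr (_ * _); rewrite mulrC.
by move=> a b /xinj/val_inj.
Qed.

End Interlacing.

(** * Measures and quadrature formulas in terms of curve parameters *)

Section Quadrature.
Variables (R : realType) (n k h : nat) (q : 'I_n.+1 -> hform R 1 h).
Hypothesis Wsurj : forall g : hform R 1 (h * k), exists f, Wq k q f = g.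

Definition node_moments (mu : {measure set (n.-tuple R) -> \bar R}) s
    (l y : 'I_s -> R) :=
  (forall i, dehom (q ord0) (y i) != 0) /\
  forall a : 'X_{1..n}, (mdeg a <= k)%N ->
    moment mu a = \sum_i l i * monomial a (curve_map q (y i)).

Lemma exists_atomic_on_curve s (l y : 'I_s -> R) :
  (forall i, 0 < l i) -> (forall i, dehom (q ord0) (y i) != 0) ->
  exists mu, [/\ supported_on mu (curve q), finite_moments mu k & node_moments mu l y].
Proof.
move=> l0 q0y; exists (atomic (curve_map q \o y) l0).
have E A (_ : measurable A) := atomicE (curve_map q \o y) l0 A.
split; last split=> // a _.
- by apply: (supported_atomic E) => i; exists (y i); first exact: q0y.
- exact: (finite_moments_atomic l0 E).
- exact: (moment_atomic l0 E).
Qed.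

Lemma has_quadrature_nodes mu s : has_quadrature mu (curve q) k s ->
  exists l y : 'I_s -> R, node_moments mu l y.
Proof.
move=> [nu [l [xi [[l0 _ nuE] Cxi mom]]]].
have /choice[y yE] i : exists z, dehom (q ord0) z != 0 /\ curve_map q z = xi i.
  by have [z ? ?] := Cxi i; exists z.
exists l, y; split=> [i|a ak]; first by have [] := yE i.
rewrite mom // (moment_atomic l0 nuE); apply: eq_bigr => i _.
by have [_ ->] := yE i.
Qed.

Lemma hankel_rank_le mu s (l y : 'I_s -> R) :
  node_moments mu l y -> (hankel_rank q k mu <= s)%N.
Proof.
by move=> [q0y mom]; apply: rank_Hankel_le (binary_coef_psiq Wsurj q0y mom).
Qed.

Lemma hankel_rank_eq mu s (l y : 'I_s -> R) : node_moments mu l y ->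
  (forall i, 0 < l i) -> injective y -> (s <= (h * k)./2.+1)%N ->
  hankel_rank q k mu = s.
Proof.
move=> [q0y mom] l0 yinj sd.
apply: rank_Hankel (binary_coef_psiq Wsurj q0y mom) _ _ _ => // i.
by rewrite mulf_neq0 ?invr_eq0 ?expf_neq0 // gt_eqF.
Qed.

End Quadrature.

(** Cauchy's root bound; it provides room for parameters at which $q_0(1, Z)$ does not vanish. *)
Lemma dehom_root_bound (R : realFieldType) d (f : hform R 1 d) : f != 0 ->
  exists2 M, 0 < M & forall z, dehom f z = 0 -> `|z| < M.
Proof.
move=> f0; have p0 : dehom_poly f != 0.
  by apply: contraNneq f0 => /dehom_poly_eq0 ->.
exists (cauchy_bound (dehom_poly f)) => [|z]; first exact: cauchy_bound_gt0.
by rewrite dehomE; exact: cauchy_boundP.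
Qed.

(** * Explicit extremal measures for (a) and (b) *)

Theorem theorem3p34 (R : realType) (n k h : nat)
    (n_gt0 : (0 < n)%N) (k_gt0 : (0 < k)%N) (h_gt0 : (0 < h)%N)
    (q : 'I_n.+1 -> hform R 1 h)
    (q0_neq0 : q ord0 != 0)
    (Wq_surj : forall g : hform R 1 (h * k), exists f, Wq k q f = g)
    (q0k_ge0 : forall z : R, 0 <= dehom (q ord0) z ^+ k) :
  (forall r : nat, (1 <= r <= uphalf (h * k + 1))%N -> r.*2 != (h * k + 1)%N ->
    exists mu : {measure set (n.-tuple R) -> \bar R},
      [/\ supported_on mu (curve q), finite_moments mu k,
          hankel_rank q k mu = r &
          forall s, (s < r)%N -> ~ has_quadrature mu (curve q) k s])
  /\
  (forall r : nat, r.*2 = (h * k + 1)%N -> (exists z : R, dehom (q ord0) z = 0) ->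
    exists mu : {measure set (n.-tuple R) -> \bar R},
      [/\ supported_on mu (curve q), finite_moments mu k,
          hankel_rank q k mu = r &
          forall s, (s < r.+1)%N -> ~ has_quadrature mu (curve q) k s]).
Proof.
have [M M_gt0 rootM] := dehom_root_bound q0_neq0.
have off_roots z : M <= `|z| -> dehom (q ord0) z != 0.
  by move=> Mz; apply/eqP => /rootM; rewrite ltNge Mz.
have off_rootsD i : dehom (q ord0) (M + i%:R) != 0.
  by apply: off_roots; rewrite ger0_norm ?lerDl // addr_ge0 // ltW.
have q0k_gt0 z : dehom (q ord0) z != 0 -> 0 < dehom (q ord0) z ^+ k.
  by move=> q0z; rewrite lt_neqAle q0k_ge0 eq_sym expf_neq0.
split=> [r /andP[_ r_le] r_neq|r rE [z q0z]].
  pose y (i : 'I_r) : R := M + i%:R.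
  (* These weights cancel the factors $q_0(1, y_i)^{-k}$, so $\psi_q(p)$ is a plain sum of powers
     $(Z_0 + y_i Z_1)^{hk}$. *)
  have l_gt0 i : 0 < dehom (q ord0) (y i) ^+ k by apply/q0k_gt0/off_rootsD.
  have [mu [mu_sup mu_fin mu_mom]] :=
    exists_atomic_on_curve k l_gt0 (fun i => off_rootsD i).
  have mu_rank : hankel_rank q k mu = r.
    apply: (hankel_rank_eq Wq_surj mu_mom) => //; last first.
      by move: r_le; rewrite addn1.
    by move=> i j /addrI/eqP; rewrite eqr_nat => /eqP/val_inj.
  exists mu; split=> // s sr /has_quadrature_nodes[l' [y' /(hankel_rank_le Wq_surj)]].
  by rewrite mu_rank leqNgt sr.
have zM := rootM z q0z.
(* The sequence $-M, z, M, M+1, \ldots$: even positions carry the atoms, odd positions the $z_i$,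
   and only position 1 holds a root of $q_0(1, Z)$. *)
pose x i : R := if i is j.+1 then if j is j'.+1 then M + j'%:R else z else - M.
have x_incr : {homo x : a b / (a < b)%N >-> a < b}.
  apply: homo_ltn lt_trans _ => -[|[|i]] /=.
  - by move: zM; rewrite ltr_norml => /andP[].
  - by rewrite addr0; move: zM; rewrite ltr_norml => /andP[].
  - by rewrite ltrD2l ltr_nat.
have x_inj : injective x.
  by move=> a b; case: (ltngtP a b) => // /x_incr + ab; rewrite ab ltxx.
have [e [e_gt0 eE]] := interlacing_moments r x_incr.
pose w (i : 'I_r.+1) := x i.*2; pose y (i : 'I_r) := x i.*2.+1.
have q0w i : dehom (q ord0) (w i) != 0.
  rewrite /w; case: i => -[|i] ? /=; last exact: off_rootsD.
  by apply: off_roots; rewrite normrN ler_norm.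
have l_gt0 (i : 'I_r.+1) : 0 < e i.*2 * dehom (q ord0) (w i) ^+ k.
  by rewrite mulr_gt0 // q0k_gt0.
have [mu [mu_sup mu_fin mu_mom]] := exists_atomic_on_curve k l_gt0 q0w.
pose c := binary_coef (psiq k q (moment_form mu k)).
(* As $hk = 2r - 1$, the interlacing identity covers every $X^j$ needed and moves the sum from $r +
   1$ even points to $r$ odd ones, giving rank $r$. *)
have cE j : (j <= h * k)%N -> c j = \sum_(i < r) e i.*2.+1 * y i ^+ j.
  move=> jd; rewrite /c (binary_coef_psiq Wq_surj q0w mu_mom.2 jd).
  have := eE 'X^j; rewrite size_polyXn rE addn1 ltnS => /(_ jd).
  under eq_bigr => i _ do rewrite hornerXn.
  under [in X in _ = X -> _]eq_bigr => i _ do rewrite hornerXn.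
  by move=> <-; apply: eq_bigr => i _; rewrite mulfK // expf_neq0.
have r_gt0 : (0 < r)%N by rewrite -double_gt0 rE addn1.
exists mu; split=> //.
  apply: rank_Hankel cE _ _ _ => [i j /x_inj /eqP|i|].
  - by rewrite eqSS => /eqP/double_inj/val_inj.
  - by rewrite gt_eqF.
  - by lia.
move=> s sr /has_quadrature_nodes[l' [y' [q0y' mom']]].
pose i0 := Ordinal r_gt0.
pose p := (\prod_(i | xpredT i) ('X - (y' i)%:P)) *
          \prod_(i | i != i0) ('X - (y i)%:P).
(* The degree is $s + (r - 1) \le 2r - 1 = hk$. *)
have p_size : (size p <= (h * k).+1)%N.
  rewrite (leq_trans (size_polyMleq _ _)) // !size_prod_XsubC_ord cardC1 !card_ord.
  by lia.
have pz : p.[z] != 0.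
  rewrite hornerM mulf_neq0 // horner_prod_XsubC_neq0 // => i.
    by move=> _; apply: contraNneq (q0y' i) => <-; rewrite q0z.
  move=> ii0; apply: contraNneq ii0; rewrite -[z]/(x 1%N) => /x_inj[] /esym/eqP.
  by rewrite double_eq0 => /eqP i0E; apply/eqP/val_inj.
have : \sum_i l' i / dehom (q ord0) (y' i) ^+ k * p.[y' i] =
    \sum_(i < r) e i.*2.+1 * p.[y i].
  apply: sum_horner_eq p_size => j jd.
  by rewrite -cE // /c (binary_coef_psiq Wq_surj q0y' mom' jd).
(* The left side vanishes, while the right side reduces to $e_1\, p(z) \ne 0$. *)
rewrite big1 => [|i _]; last by rewrite hornerM horner_prod_XsubC_eq0 ?mul0r ?mulr0.
rewrite (bigD1 i0) //= big1 ?addr0 => [/esym/eqP|i ii0]; last first.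
  by rewrite hornerM (@horner_prod_XsubC_eq0 _ _ (fun i => i != i0)) ?mulr0.
by rewrite mulf_eq0 (negbTE pz) orbF gt_eqF.
Qed.
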